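(* The Point-To-Point Reachability problem (P2P) for polynomial recursive sequences is decidable relative to an oracle for the problem SPInv; that is, P2P is reducible to SPInv: there is an algorithm which, given access to an oracle that on input any deterministic unguarded loop with polynomial updates returns a finite basis of its polynomial invariant ideal, decides every instance of P2P.
   Context: The P2P problem: given $k\ge1$, polynomials $p_1,\dots,p_k\in\mathbb{Q}[y_1,\dots,y_k]$, initial values $u_1(0),\dots,u_k(0)\in\mathbb{Q}$, defining sequences by $u_i(n+1)=p_i(u_1(n),\dots,u_k(n))$ for all $n\ge0$, and a target vector $(t_1,\dots,t_k)\in\mathbb{Q}^k$, decide whether there exists $m\in\mathbb{N}_0$ with $u_i(m)=t_i$ for all $i$. A deterministic unguarded loop with polynomial updates over variables $x_1,\dots,x_d$ is given by an initial vector $v\in\mathbb{Q}^d$ and an update map $F=(f_1,\dots,f_d)$ with $f_j\in\mathbb{Q}[x_1,\dots,x_d]$; its reachable states are $F^n(v)$, $n\in\mathbb{N}_0$ (with $F^0(v)=v$). Its polynomial invariant ideal is $\{p\in\overline{\mathbb{Q}}[x_1,\dots,x_d] : p(F^n(v))=0 \text{ for all } n\in\mathbb{N}_0\}$, an ideal of $\overline{\mathbb{Q}}[x_1,\dots,x_d]$ ($\overline{\mathbb{Q}}$ the algebraic numbers). The problem SPInv: given such a loop, compute a finite generating set (basis) of its polynomial invariant ideal. *)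

(* Defs.v *)
From HB Require Import structures.
From mathcomp Require Import all_boot all_order all_algebra all_field.
From mathcomp Require Import mpoly.
Set Implicit Arguments. Unset Strict Implicit. Unset Printing Implicit Defensive.
Import Order.TTheory GRing.Theory Num.Theory.
Local Open Scope ring_scope.

(* A polynomial with rational coefficients in variables x_0..x_{k-1}, given   *)
(* as a finite list of monomials (coefficient, exponent vector).            *)
Definition qpoly := seq (rat * seq nat).

Record p2p_inst := P2PInst {
  p2p_k : nat; p2p_polys : seq qpoly; p2p_init : seq rat; p2p_target : seq rat }.

Record loop := Loop { loop_d : nat; loop_upd : seq qpoly; loop_init : seq rat }.

(* An algebraic number given by a (nonzero) rational polynomial (coefficient *)
(* list, constant term first) and a rational box [a,b] x [c,d] of the complex *)
(* plane isolating exactly one of its roots.                                 *)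
Definition algcode := (seq rat * (rat * rat * rat * rat))%type.

Definition apoly := seq (algcode * seq nat).

Definition eval_qpoly (P : qpoly) (x : seq rat) : rat :=
  \sum_(m <- P) m.1 * \prod_(i < size m.2) (nth 0 x i) ^+ (nth 0%N m.2 i).

Definition step (ps : seq qpoly) (x : seq rat) : seq rat :=
  map (fun P => eval_qpoly P x) ps.

Definition qpoly_wf (k : nat) (P : qpoly) : bool := all (fun m => size m.2 == k) P.

Definition p2p_wf (I : p2p_inst) : Prop :=
  [/\ (1 <= p2p_k I)%N, size (p2p_polys I) = p2p_k I,
      all (qpoly_wf (p2p_k I)) (p2p_polys I),
      size (p2p_init I) = p2p_k I & size (p2p_target I) = p2p_k I].

Definition p2p_reach (I : p2p_inst) : Prop :=
  exists m : nat, iter m (step (p2p_polys I)) (p2p_init I) = p2p_target I.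

Definition loop_wf (L : loop) : Prop :=
  [/\ size (loop_upd L) = loop_d L, all (qpoly_wf (loop_d L)) (loop_upd L)
    & size (loop_init L) = loop_d L].

Definition loop_state (L : loop) (n : nat) : 'I_(loop_d L) -> algC :=
  fun i => ratr (nth 0 (iter n (step (loop_upd L)) (loop_init L)) i).

Definition inv_ideal (L : loop) (p : {mpoly algC[loop_d L]}) : Prop :=
  forall n : nat, meval (@loop_state L n) p = 0.

Definition in_ideal_gen (d : nat) (B : seq {mpoly algC[d]}) (p : {mpoly algC[d]}) : Prop :=
  exists qs : seq {mpoly algC[d]}, size qs = size B /\
    p = \sum_(j < size B) qs`_j * B`_j.

Definition alg_den (c : algcode) (z : algC) : Prop :=
  let: (p, (a, b, c', d')) := c in
  let inbox w := [&& ratr a <= 'Re w, 'Re w <= ratr b,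
                     ratr c' <= 'Im w & 'Im w <= ratr d'] in
  [/\ Poly p != 0, (map_poly ratr (Poly p) : {poly algC}).[z] = 0, inbox z &
      forall w : algC, (map_poly ratr (Poly p) : {poly algC}).[w] = 0 -> inbox w -> w = z].

Definition mnm_of (d : nat) (e : seq nat) : 'X_{1..d} := [multinom nth 0%N e i | i < d].

Fixpoint apoly_den (d : nat) (P : apoly) (q : {mpoly algC[d]}) : Prop :=
  match P with
  | [::] => q = 0
  | (c, e) :: P' => exists (z : algC) (q' : {mpoly algC[d]}),
      [/\ size e = d, alg_den c z, apoly_den P' q' & q = z *: 'X_[@mnm_of d e] + q']
  end.

Definition basis_den (d : nat) (A : seq apoly) (B : seq {mpoly algC[d]}) : Prop :=
  size A = size B /\ forall j, (j < size A)%N -> apoly_den (nth [::] A j) B`_j.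

Definition pairn (a b : nat) : nat := (2 ^ a * b.*2.+1)%N.
Fixpoint enc_list (s : seq nat) : nat :=
  if s is x :: s' then pairn x (enc_list s') else 0%N.
Definition enc_int (z : int) : nat :=
  match z with Posz n => n.*2 | Negz n => n.*2.+1 end.
Definition enc_rat (q : rat) : nat := pairn (enc_int (numq q)) (enc_int (denq q)).
Definition enc_qpoly (P : qpoly) : nat :=
  enc_list (map (fun m => pairn (enc_rat m.1) (enc_list m.2)) P).
Definition enc_p2p (I : p2p_inst) : nat :=
  pairn (p2p_k I) (pairn (enc_list (map enc_qpoly (p2p_polys I)))
    (pairn (enc_list (map enc_rat (p2p_init I))) (enc_list (map enc_rat (p2p_target I))))).
Definition enc_loop (L : loop) : nat :=
  pairn (loop_d L) (pairn (enc_list (map enc_qpoly (loop_upd L)))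
                          (enc_list (map enc_rat (loop_init L)))).
Definition enc_algcode (c : algcode) : nat :=
  let: (p, (a, b, c', d')) := c in
  pairn (enc_list (map enc_rat p))
        (pairn (enc_rat a) (pairn (enc_rat b) (pairn (enc_rat c') (enc_rat d')))).
Definition enc_apoly (P : apoly) : nat :=
  enc_list (map (fun m => pairn (enc_algcode m.1) (enc_list m.2)) P).
Definition enc_basis (A : seq apoly) : nat := enc_list (map enc_apoly A).

Inductive prog : Type :=
| PZero
| PSucc
| PProj of nat
| POrc
| PComp of prog & seq prog
| PPrim of prog & prog
| PMu of prog.

Inductive eval (O : nat -> nat) : prog -> seq nat -> nat -> Prop :=
| eZero a : eval O PZero a 0
| eSucc a : eval O PSucc a (nth 0%N a 0).+1
| eProj i a : eval O (PProj i) a (nth 0%N a i)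
| eOrc a : eval O POrc a (O (nth 0%N a 0))
| eComp f gs a bs r : evals O gs a bs -> eval O f bs r -> eval O (PComp f gs) a r
| ePrim0 f g a r : eval O f a r -> eval O (PPrim f g) (0%N :: a) r
| ePrimS f g n a r s : eval O (PPrim f g) (n :: a) r -> eval O g (n :: r :: a) s ->
    eval O (PPrim f g) (n.+1 :: a) s
| eMu f a n : eval O f (n :: a) 0 ->
    (forall m, (m < n)%N -> exists r, eval O f (m :: a) r.+1) -> eval O (PMu f) a n
with evals (O : nat -> nat) : seq prog -> seq nat -> seq nat -> Prop :=
| esNil a : evals O [::] a [::]
| esCons g gs a b bs : eval O g a b -> evals O gs a bs -> evals O (g :: gs) a (b :: bs).

Definition SPInv_oracle (O : nat -> nat) : Prop :=
  forall L : loop, loop_wf L ->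
    exists (A : seq apoly) (B : seq {mpoly algC[loop_d L]}),
      [/\ O (enc_loop L) = enc_basis A, basis_den A B &
          forall p, in_ideal_gen B p <-> inv_ideal p].

(* Main.v *)
Require Import Defs.
From HB Require Import structures.
From mathcomp Require Import all_boot all_order all_algebra all_field.
From mathcomp Require Import mpoly.
From mathcomp Require Import ring.
From Stdlib Require Import Classical ClassicalEpsilon.
Import Defs.
Set Implicit Arguments. Unset Strict Implicit. Unset Printing Implicit Defensive.
Import Order.TTheory GRing.Theory Num.Theory.
Local Open Scope nat_scope.

(* Add to the P2P recursion x a variable y with y(0) = 1 and y := y * |x - t|^2, so that
   y(n) = 0 exactly when t was hit before time n; let s_n = (y(n), x(n)). Ask the oracle for
   the ideal of the tail s_(m+1), s_(m+2), ... for every m. By Noetherianity some s_m lies in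
   the Zariski closure of its own tail. If E is the set of exponent vectors occurring in the
   returned basis, this holds iff the vector (s_m^a)_(a in E) is a rational combination of the
   vectors (s_j^a)_(a in E), j > m, which is semi-decidable and needs no computation with
   algebraic numbers. If y(m+1) <> 0 and t is hit later, the tail consists of finitely many
   points and of points with y = 0, so s_m in its closure would force a cycle along which y
   stays nonzero, a contradiction. Hence searching simultaneously for a hit and for such a
   certificate always stops, with the right answer. *)

(** * Recursive functions on tuples of numbers *)

(** The program is chosen before the oracle, so one program serves every oracle. The arity is fixed
    because arguments are copied or dropped by explicit lists of projections. *)
Definition total_rec (k : nat) (f : seq nat -> nat) : Prop :=
  exists p, forall O a, size a = k -> eval O p a (f a).

Lemma total_rec_ext k f g :
  (forall a, size a = k -> f a = g a) -> total_rec k f -> total_rec k g.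
Proof. by move=> fg [p Hp]; exists p => O a sz; rewrite -fg //; apply: Hp. Qed.

Lemma total_rec_nth k i : total_rec k (fun a => nth 0 a i).
Proof. by exists (PProj i) => O a _; constructor. Qed.

Lemma total_rec_succ k f : total_rec k f -> total_rec k (fun a => (f a).+1).
Proof.
move=> [p Hp]; exists (PComp PSucc [:: p]) => O a sz.
apply: (@eComp _ _ _ _ [:: f a]); last exact: eSucc.
by apply: esCons; [exact: Hp | exact: esNil].
Qed.

Lemma total_rec_const k n : total_rec k (fun=> n).
Proof.
elim: n => [|n IH]; last exact: total_rec_succ.
by exists PZero => O a _; constructor.
Qed.

Lemma evals_proj O (a : seq nat) m k :
  evals O [seq PProj i | i <- iota m k] a [seq nth 0 a i | i <- iota m k].
Proof. by elim: k m => [|k IH] m /=; constructor=> //; constructor. Qed.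

Lemma evals_proj_id O a k : size a = k -> evals O [seq PProj i | i <- iota 0 k] a a.
Proof. by move=> <-; have := evals_proj O a 0 (size a); rewrite [map (nth _ _) _](mkseq_nth 0 a). Qed.

Lemma total_rec_behead k f : total_rec k f -> total_rec k.+1 (fun a => f (behead a)).
Proof.
move=> [p Hp]; exists (PComp p [seq PProj i | i <- iota 1 k]) => O a sz.
apply: (@eComp _ _ _ _ (behead a)); last by apply: Hp; rewrite size_behead sz.
have := evals_proj O a 1 k; suff -> : [seq nth 0 a i | i <- iota 1 k] = behead a by [].
case: a sz => //= x a [<-]; rewrite (iotaDl 1 0) -map_comp.
exact: (mkseq_nth 0 a).
Qed.

Lemma total_rec_iteri k n (g : nat -> nat -> seq nat -> nat) x :
  total_rec k n -> total_rec k x ->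
  total_rec k.+2 (fun b => g (nth 0 b 0) (nth 0 b 1) (behead (behead b))) ->
  total_rec k (fun a => iteri (n a) (fun i r => g i r a) (x a)).
Proof.
move=> [pn Hn] [px Hx] [pg Hg].
exists (PComp (PPrim px pg) (pn :: [seq PProj i | i <- iota 0 k])) => O a sz.
apply: (@eComp _ _ _ _ (n a :: a)).
  by apply: esCons; [exact: Hn | exact: evals_proj_id].
elim: (n a) => [|m IH] /=; first by constructor; apply: Hx.
apply: ePrimS; first exact: IH.
by apply: (Hg O (m :: _ :: a)); rewrite /= sz.
Qed.

Lemma total_rec_mu k (f : nat -> seq nat -> nat) g :
  total_rec k.+1 (fun b => f (nth 0 b 0) (behead b)) ->
  (forall a, f (g a) a = 0) -> (forall a m, m < g a -> 0 < f m a) ->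
  total_rec k g.
Proof.
move=> [p Hp] g0 gmin; exists (PMu p) => O a sz; apply: eMu.
  by have := Hp O (g a :: a); rewrite /= g0; apply; rewrite sz.
move=> m lt_m; exists (f m a).-1; rewrite prednK ?gmin //.
by apply: (Hp O (m :: a)); rewrite /= sz.
Qed.

Lemma total_rec_add k f g :
  total_rec k f -> total_rec k g -> total_rec k (fun a => f a + g a).
Proof.
move=> Hf Hg; apply: (@total_rec_ext k (fun a => iteri (f a) (fun _ r => r.+1) (g a))).
  by move=> a _; elim: (f a) => //= n ->; rewrite addSn.
apply: (@total_rec_iteri k f (fun _ r _ => r.+1) g) => //.
exact/total_rec_succ/total_rec_nth.
Qed.

Lemma total_rec_pred k f : total_rec k f -> total_rec k (fun a => (f a).-1).
Proof.
move=> Hf; apply: (@total_rec_ext k (fun a => iteri (f a) (fun i _ => i) 0)).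
  by move=> a _; case: (f a).
apply: (@total_rec_iteri k f (fun i _ _ => i) (fun=> 0)) => //.
  exact: total_rec_const.
exact: total_rec_nth.
Qed.

Lemma total_rec_sub k f g :
  total_rec k f -> total_rec k g -> total_rec k (fun a => f a - g a).
Proof.
move=> Hf Hg; apply: (@total_rec_ext k (fun a => iteri (g a) (fun _ r => r.-1) (f a))).
  by move=> a _; elim: (g a) => /= [|n ->]; rewrite ?subn0 ?subnS.
apply: (@total_rec_iteri k g (fun _ r _ => r.-1) f) => //.
exact/total_rec_pred/total_rec_nth.
Qed.

Lemma total_rec_mul k f g :
  total_rec k f -> total_rec k g -> total_rec k (fun a => f a * g a).
Proof.
move=> Hf Hg; apply: (@total_rec_ext k (fun a => iteri (f a) (fun _ r => g a + r) 0)).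
  by move=> a _; elim: (f a) => //= n ->; rewrite mulSn.
apply: (@total_rec_iteri k f (fun _ r a => g a + r) (fun=> 0)) => //.
  exact: total_rec_const.
apply: total_rec_add; last exact: total_rec_nth.
exact: (total_rec_behead (total_rec_behead Hg)).
Qed.

Lemma total_rec_pow2 k f : total_rec k f -> total_rec k (fun a => 2 ^ f a).
Proof.
move=> Hf; apply: (@total_rec_ext k (fun a => iteri (f a) (fun _ r => 2 * r) 1)).
  by move=> a _; elim: (f a) => //= n ->; rewrite expnS.
apply: (@total_rec_iteri k f (fun _ r _ => 2 * r) (fun=> 1)) => //.
  exact: total_rec_const.
by apply: total_rec_mul; [exact: total_rec_const | exact: total_rec_nth].
Qed.

Lemma total_rec_if k c f g :
  total_rec k c -> total_rec k f -> total_rec k g ->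
  total_rec k (fun a => if 0 < c a then f a else g a).
Proof.
move=> Hc Hf Hg; apply: (@total_rec_ext k (fun a => iteri (c a) (fun _ _ => f a) (g a))).
  by move=> a _; case: (c a).
apply: (@total_rec_iteri k c (fun _ _ a => f a) g) => //.
exact: (total_rec_behead (total_rec_behead Hf)).
Qed.

Lemma total_rec_half k f : total_rec k f -> total_rec k (fun a => (f a)./2).
Proof.
(* [n - (2 * h).+1] vanishes iff [n <= 2 * h + 1], and the least such [h] is half of [n]. *)
move=> Hf; apply: (@total_rec_mu k (fun h a => f a - (2 * h).+1)).
- apply: total_rec_sub; first exact: total_rec_behead.
  apply/total_rec_succ/total_rec_mul; [exact: total_rec_const|exact: total_rec_nth].
- move=> a; apply/eqP; rewrite subn_eq0 mul2n.
  by rewrite -{1}(odd_double_half (f a)); case: odd.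
- move=> a m; rewrite subn_gt0 mul2n -leq_double => H.
  by rewrite -{1}(odd_double_half (f a)) ltn_addl.
Qed.

Lemma total_rec_odd k f : total_rec k f -> total_rec k (fun a => odd (f a)).
Proof.
move=> Hf; apply: (@total_rec_ext k (fun a => f a - 2 * (f a)./2)).
  by move=> a _; rewrite mul2n -{1}(odd_double_half (f a)) addnK.
apply: total_rec_sub => //; apply: total_rec_mul; first exact: total_rec_const.
exact: total_rec_half.
Qed.

(** Halving stops at an odd number. As many as [n] rounds suffice, since a power [2 ^ a] dividing a
    positive [n] has [a <= n]; surplus rounds change nothing. *)
Definition odd_part n := iteri n (fun _ r => if 0 < odd r then r else r./2) n.

Lemma odd_part_pairn a b : odd_part (pairn a b) = b.*2.+1.
Proof.
have odd_fix m : iteri m (fun _ r => if 0 < odd r then r else r./2) b.*2.+1 = b.*2.+1.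
  by elim: m => //= m ->; rewrite /= odd_double.
have shift (f : nat -> nat) m x : iteri m.+1 (fun _ => f) x = iteri m (fun _ => f) (f x).
  by elim: m => //= m ->.
have gen m : a <= m -> iteri m (fun _ r => if 0 < odd r then r else r./2) (pairn a b) = b.*2.+1.
  elim: a m => [|a' IH] [|m] //; rewrite /pairn ?mul1n //.
  move=> ?; rewrite shift expnS -mulnA mul2n odd_double /= doubleK; exact: IH.
apply: gen; rewrite /pairn; apply: (leq_trans (ltnW (ltn_expl a (isT : 1 < 2)))).
by rewrite leq_pmulr.
Qed.

Lemma total_rec_odd_part k f : total_rec k f -> total_rec k (fun a => odd_part (f a)).
Proof.
move=> Hf; apply: (@total_rec_iteri k f (fun _ r _ => if 0 < odd r then r else r./2) f) => //.
apply: total_rec_if; [apply: total_rec_odd | | apply: total_rec_half]; exact: total_rec_nth.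
Qed.

Lemma pairn_gt0 a b : 0 < pairn a b.
Proof. by rewrite muln_gt0 expn_gt0. Qed.

Lemma ltn_pairn a b : b < pairn a b.
Proof.
rewrite /pairn (leq_trans (n := b.*2.+1)) ?leq_pmull ?expn_gt0 //.
by rewrite ltnS -addnn leq_addr.
Qed.

Lemma pairn_rec : exists p, forall O a b, eval O p [:: a; b] (pairn a b).
Proof.
have : total_rec 2 (fun a => 2 ^ nth 0 a 0 * (2 * nth 0 a 1).+1).
  apply: total_rec_mul; first exact/total_rec_pow2/total_rec_nth.
  apply/total_rec_succ/total_rec_mul; [exact: total_rec_const|exact: total_rec_nth].
move=> [p Hp]; exists p => O a b.
by have := Hp O [:: a; b] erefl; rewrite /= mul2n.
Qed.

Lemma pairn2_rec : exists p, forall O a b, eval O p [:: pairn a b] b.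
Proof.
have : total_rec 1 (fun a => (odd_part (nth 0 a 0))./2).
  exact/total_rec_half/total_rec_odd_part/total_rec_nth.
move=> [p Hp]; exists p => O a b; have := Hp O [:: pairn a b] erefl.
by rewrite /= odd_part_pairn /= uphalf_double.
Qed.

(** For a pair code [c], the first component is the least [m] with [c <= 2 ^ m * odd_part c], which
    unbounded search finds. *)
Lemma pairn1_rec : exists p, forall O a b, eval O p [:: pairn a b] a.
Proof.
have : total_rec 2 (fun a => nth 0 a 1 - 2 ^ nth 0 a 0 * odd_part (nth 0 a 1)).
  apply: total_rec_sub; first exact: total_rec_nth.
  apply: total_rec_mul; first exact/total_rec_pow2/total_rec_nth.
  exact/total_rec_odd_part/total_rec_nth.
move=> [p Hp]; exists (PMu p) => O a b; apply: eMu.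
  have := Hp O [:: a; pairn a b] erefl.
  by rewrite /= odd_part_pairn subnn.
move=> m lt_ma; have := Hp O [:: m; pairn a b] erefl; rewrite /= odd_part_pairn.
set d := _ - _ => H; exists d.-1; rewrite prednK // subn_gt0 ltn_pmul2r //.
by rewrite ltn_exp2l.
Qed.

(** * Computable functions between coded types *)

(** Nothing but a map to numbers is asked, since programs only transport codes. The instances are
    built to agree with the encoders of the statement. *)
Class code (T : Type) := encode : T -> nat.
#[export] Instance code_nat : code nat := id.
#[export] Instance code_bool : code bool := nat_of_bool.
#[export] Instance code_int : code int := enc_int.
#[export] Instance code_rat : code rat := enc_rat.
#[export] Instance code_prod T U (cT : code T) (cU : code U) : code (T * U) :=
  fun x => pairn (encode x.1) (encode x.2).
#[export] Instance code_seq T (cT : code T) : code (seq T) :=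
  fun s => enc_list (map encode s).

Definition computable {T U} {cT : code T} {cU : code U} (f : T -> U) : Prop :=
  exists p, forall O x, eval O p [:: encode x] (encode (f x)).

Lemma evals1 O p a b : eval O p a b -> evals O [:: p] a [:: b].
Proof. by move=> H; apply: esCons => //; apply: esNil. Qed.

Lemma evals2 O p q a b c : eval O p a b -> eval O q a c -> evals O [:: p; q] a [:: b; c].
Proof. by move=> H K; apply: esCons => //; apply: evals1. Qed.

Section Computable.
Context {T : Type} {cT : code T}.

Lemma eq_computable {U} {cU : code U} (f g : T -> U) : f =1 g -> computable f -> computable g.
Proof. by move=> fg [p Hp]; exists p => O x; rewrite -fg. Qed.

(** Programs see only codes, so a computation may be retyped whenever the codes agree: a number
    below 2 is also a Boolean, a pair of a head and a tail is also a list. *)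
Lemma computable_code {U V} {cU : code U} {cV : code V} (f : T -> U) (g : T -> V) :
  (forall x, encode (f x) = encode (g x)) -> computable f -> computable g.
Proof. by move=> fg [p Hp]; exists p => O x; rewrite -fg. Qed.

Lemma computable_id : computable (fun x : T => x).
Proof. by exists (PProj 0) => O x; exact: (eProj O 0 [:: encode x]). Qed.

Lemma computable_const {U} {cU : code U} (u : U) : computable (fun _ : T => u).
Proof.
by have [p Hp] := total_rec_const 1 (encode u); exists p => O x; apply: (Hp O [:: encode x]).
Qed.

Lemma computable_comp {U V} {cU : code U} {cV : code V} (f : T -> U) (g : U -> V) :
  computable f -> computable g -> computable (fun x => g (f x)).
Proof.
move=> [p Hp] [q Hq]; exists (PComp q [:: p]) => O x.
by apply: eComp; [apply/evals1/Hp | apply: Hq].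
Qed.

Lemma computable_pair {U V} {cU : code U} {cV : code V} (f : T -> U) (g : T -> V) :
  computable f -> computable g -> computable (fun x => (f x, g x)).
Proof.
move=> [p Hp] [q Hq]; have [r Hr] := pairn_rec; exists (PComp r [:: p; q]) => O x.
by apply: eComp; [apply: evals2; [apply: Hp|apply: Hq] | apply: Hr].
Qed.

Lemma computable_fst {U V} {cU : code U} {cV : code V} (f : T -> U * V) :
  computable f -> computable (fun x => (f x).1).
Proof.
move=> [p Hp]; have [r Hr] := pairn1_rec; exists (PComp r [:: p]) => O x.
by apply: eComp; [apply/evals1/Hp | apply: Hr].
Qed.

Lemma computable_snd {U V} {cU : code U} {cV : code V} (f : T -> U * V) :
  computable f -> computable (fun x => (f x).2).
Proof.
move=> [p Hp]; have [r Hr] := pairn2_rec; exists (PComp r [:: p]) => O x.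
by apply: eComp; [apply/evals1/Hp | apply: Hr].
Qed.

Lemma computable_nat1 (h : nat -> nat) (f : T -> nat) :
  total_rec 1 (fun a => h (nth 0 a 0)) -> computable f -> computable (fun x => h (f x)).
Proof.
move=> [q Hq] [p Hp]; exists (PComp q [:: p]) => O x.
by apply: eComp; [apply/evals1/Hp | apply: (Hq O [:: _])].
Qed.

Lemma computable_nat2 (h : nat -> nat -> nat) (f g : T -> nat) :
  total_rec 2 (fun a => h (nth 0 a 0) (nth 0 a 1)) ->
  computable f -> computable g -> computable (fun x => h (f x) (g x)).
Proof.
move=> [r Hr] [p Hp] [q Hq]; exists (PComp r [:: p; q]) => O x.
by apply: eComp; [apply: evals2; [apply: Hp|apply: Hq] | apply: (Hr O [:: _; _])].
Qed.

Lemma computable_succ (f : T -> nat) : computable f -> computable (fun x => (f x).+1).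
Proof. by apply: computable_nat1; apply/total_rec_succ/total_rec_nth. Qed.

Lemma computable_pred (f : T -> nat) : computable f -> computable (fun x => (f x).-1).
Proof. by apply: computable_nat1; apply/total_rec_pred/total_rec_nth. Qed.

Lemma computable_half (f : T -> nat) : computable f -> computable (fun x => (f x)./2).
Proof. by apply: computable_nat1; apply/total_rec_half/total_rec_nth. Qed.

Lemma computable_add (f g : T -> nat) :
  computable f -> computable g -> computable (fun x => f x + g x).
Proof. by apply: computable_nat2; apply/total_rec_add; apply/total_rec_nth. Qed.

Lemma computable_sub (f g : T -> nat) :
  computable f -> computable g -> computable (fun x => f x - g x).
Proof. by apply: computable_nat2; apply/total_rec_sub; apply/total_rec_nth. Qed.

Lemma computable_mul (f g : T -> nat) :
  computable f -> computable g -> computable (fun x => f x * g x).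
Proof. by apply: computable_nat2; apply/total_rec_mul; apply/total_rec_nth. Qed.

Lemma computable_odd (f : T -> nat) : computable f -> computable (fun x => odd (f x)).
Proof.
move=> Hf; apply: (@computable_code nat bool _ _ (fun x => nat_of_bool (odd (f x)))) => //.
by apply: (@computable_nat1 (fun n => odd n)) => //; apply/total_rec_odd/total_rec_nth.
Qed.

Lemma computable_eq0 (f : T -> nat) : computable f -> computable (fun x => f x == 0).
Proof.
move=> Hf; apply: (@computable_code nat bool _ _ (fun x => 1 - f x)).
  by move=> x; case: (f x).
by apply: computable_sub => //; apply: computable_const.
Qed.

Lemma computable_leq (f g : T -> nat) :
  computable f -> computable g -> computable (fun x => f x <= g x).
Proof. by move=> Hf Hg; apply/computable_eq0/computable_sub. Qed.

Lemma computable_iter {U} {cU : code U} (n : T -> nat) (f : T -> U -> U) (u : T -> U) :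
  computable (fun p : T * U => f p.1 p.2) -> computable n -> computable u ->
  computable (fun x => iter (n x) (f x) (u x)).
Proof.
move=> [pf Hf] [pn Hn] [pu Hu]; have [r Hr] := pairn_rec.
(* In the recursion step, places 0, 1 and 2 hold the counter, the current value and the code of [x];
   hence the pair of projections 2 and 1. *)
exists (PComp (PPrim pu (PComp pf [:: PComp r [:: PProj 2; PProj 1]]))
              [:: pn; PProj 0]) => O x.
apply: eComp; first by apply: evals2; [apply: Hn | apply: eProj].
rewrite /=; set m := encode _; rewrite -[n x]/m; elim: m => [|m IH] /=.
  by apply: ePrim0; apply: Hu.
apply: ePrimS; first exact: IH.
apply: eComp; last exact: (Hf O (x, _)).
by apply/evals1/eComp; [apply: evals2; apply: eProj | apply: Hr].
Qed.

End Computable.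

Lemma encode_cons {U} {cU : code U} (u : U) s :
  encode (u :: s) = pairn (encode u) (encode s).
Proof. by []. Qed.

Section ComputableControl.
Context {T : Type} {cT : code T}.

Lemma computable_if {U} {cU : code U} (b : T -> bool) (f g : T -> U) :
  computable b -> computable f -> computable g ->
  computable (fun x => if b x then f x else g x).
Proof.
move=> Hb Hf Hg.
apply: (eq_computable (f := fun x => iter (b x) (fun=> f x) (g x))).
  by move=> x; case: (b x).
apply: (computable_iter (n := fun x => nat_of_bool (b x)) (f := fun x _ => f x)) => //.
exact: (computable_comp (computable_fst computable_id) Hf).
Qed.

(** The empty list has code 0; a nonempty one has a positive code, which is already that of the pair
    of its head and tail. So [1 - (1 - c)] rounds of primitive recursion, zero or one, make the case
    distinction. *)
Lemma computable_nilcons {U V} {cU : code U} {cV : code V}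
    (s : T -> seq U) (f : T -> U -> seq U -> V) (g : T -> V) :
  computable s -> computable (fun p : T * (U * seq U) => f p.1 p.2.1 p.2.2) ->
  computable g -> computable (fun x => if s x is u :: s' then f x u s' else g x).
Proof.
move=> [ps Hs] [pf Hf] [pg Hg]; have [r Hr] := pairn_rec.
have [q Hq] := total_rec_sub (total_rec_const 1 1)
  (total_rec_sub (total_rec_const 1 1) (total_rec_nth 1 0)).
exists (PComp (PPrim pg (PComp pf [:: PComp r [:: PProj 2; PComp ps [:: PProj 2]]]))
              [:: PComp q [:: ps]; PProj 0]) => O x.
apply: eComp.
  apply: evals2; last exact: eProj.
  by apply: eComp; [apply/evals1/Hs | apply: (Hq O [:: _])].
have := Hs O x; rewrite /=; case: (s x) => [|u s']; last rewrite encode_cons; move=> Hs'.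
  by apply: ePrim0; apply: Hg.
have sub11 c : 0 < c -> 1 - (1 - c) = 1 by case: c.
rewrite sub11 ?pairn_gt0 //.
apply: ePrimS; first by apply: ePrim0; apply: Hg.
apply: eComp; last exact: (Hf O (x, (u, s'))).
apply/evals1/eComp; last exact: Hr.
apply: evals2; first exact: eProj.
by apply: eComp; [apply/evals1/eProj|].
Qed.

Lemma computable_cons {U} {cU : code U} (f : T -> U) (s : T -> seq U) :
  computable f -> computable s -> computable (fun x => f x :: s x).
Proof.
move=> Hf Hs; apply: computable_code (computable_pair Hf Hs) => x //.
Qed.

Lemma computable_mu (P : T -> nat -> bool) (f : T -> nat) :
  (forall x, P x (f x)) -> (forall x n, n < f x -> ~~ P x n) ->
  computable (fun p : T * nat => P p.1 p.2) -> computable f.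
Proof.
move=> Pf Pmin [p Hp]; have [r Hr] := pairn_rec.
have [q Hq] := total_rec_sub (total_rec_const 1 1) (total_rec_nth 1 0).
have eval_body O x n :
    eval O (PComp q [:: PComp p [:: PComp r [:: PProj 1; PProj 0]]]) [:: n; encode x] (1 - P x n).
  apply: eComp; last exact: (Hq O [:: _]).
  apply/evals1/eComp; last exact: (Hp O (x, n)).
  by apply/evals1/eComp; [apply: evals2; apply: eProj | apply: Hr].
exists (PMu (PComp q [:: PComp p [:: PComp r [:: PProj 1; PProj 0]]])) => O x.
apply: eMu; first by have := eval_body O x (f x); rewrite Pf.
by move=> m /Pmin nP; exists 0; have := eval_body O x m; rewrite (negbTE nP).
Qed.

End ComputableControl.

Section ComputableSeq.
Context {T U : Type} {cT : code T} {cU : code U}.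

Lemma computable_behead (s : T -> seq U) : computable s -> computable (fun x => behead (s x)).
Proof.
move=> Hs.
apply: (eq_computable (f := fun x => if s x is u :: s' then s' else [::])).
  by move=> x; case: (s x).
apply: (computable_nilcons (f := fun _ _ s' => s') (g := fun=> [::])) => //.
  exact/computable_snd/computable_snd/computable_id.
exact: computable_const.
Qed.

Lemma computable_head (u0 : U) (s : T -> seq U) :
  computable s -> computable (fun x => head u0 (s x)).
Proof.
move=> Hs.
apply: (eq_computable (f := fun x => if s x is u :: s' then u else u0)).
  by move=> x; case: (s x).
apply: (computable_nilcons (f := fun _ u _ => u) (g := fun=> u0)) => //.
  exact/computable_fst/computable_snd/computable_id.
exact: computable_const.
Qed.

Lemma size_encode (s : seq U) : size s <= encode s.
Proof. by elim: s => //= u s IH; apply: leq_trans (ltn_pairn _ _). Qed.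

(** A fold is an iteration that consumes one entry per round. The code of the list is at least its
    length and serves as the number of rounds; surplus rounds are idle on the empty list. *)
Lemma computable_foldl {V} {cV : code V} (f : T -> V -> U -> V) (v : T -> V) (s : T -> seq U) :
  computable (fun p : T * V * U => f p.1.1 p.1.2 p.2) -> computable v -> computable s ->
  computable (fun x => foldl (f x) (v x) (s x)).
Proof.
move=> Hf Hv Hs.
pose stp x (p : seq U * V) := if p.1 is u :: s' then (s', f x p.2 u) else p.
apply: (eq_computable (f := fun x => (iter (encode (s x)) (stp x) (s x, v x)).2)).
  move=> x; have iter_nil n w : iter n (stp x) ([::], w) = ([::], w) by elim: n => //= n ->.
  suff gen n l w : size l <= n -> iter n (stp x) (l, w) = ([::], foldl (f x) w l).
    by rewrite gen ?size_encode.
  elim: l n w => [|u l IH] n w; first by rewrite iter_nil.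
  by case: n => // n le_n; rewrite iterSr IH.
apply/computable_snd/computable_iter; last exact: computable_pair.
  apply: (computable_nilcons (s := fun q : T * (seq U * V) => q.2.1)
    (f := fun q u s' => (s', f q.1 q.2.2 u)) (g := fun q => q.2)).
  - exact/computable_fst/computable_snd/computable_id.
  - apply: computable_pair; first exact/computable_snd/computable_snd/computable_id.
    apply: (computable_comp (f := fun q => (q.1.1, q.1.2.2, q.2.1)) _ Hf).
    apply: computable_pair; last exact/computable_fst/computable_snd/computable_id.
    apply: computable_pair; first exact/computable_fst/computable_fst/computable_id.
    exact/computable_snd/computable_snd/computable_fst/computable_id.
  - exact/computable_snd/computable_id.
exact: computable_code Hs.
Qed.

End ComputableSeq.

(** * Syntax-directed automation for computability *)

Ltac computability_step := lazymatch goal with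
  | |- computable (fun _ => ?c) => apply: computable_const
  | |- computable (fun x => x) => apply: computable_id
  | |- computable (@fst _ _) => exact: (computable_fst computable_id)
  | |- computable (@snd _ _) => exact: (computable_snd computable_id)
  | |- computable (fun x => fst _) => apply: computable_fst
  | |- computable (fun x => snd _) => apply: computable_snd
  | |- computable (fun x => pair _ _) => apply: computable_pair
  | |- computable (fun x => cons _ _) => apply: computable_cons
  | |- computable (fun x => behead _) => apply: computable_behead
  | |- computable (fun x => head _ _) => apply: computable_head
  | |- computable (fun x => foldl _ _ _) => apply: computable_foldl
  | |- computable (fun x => S _) => apply: computable_succ
  | |- computable (fun x => predn _) => apply: computable_pred
  | |- computable (fun x => half _) => apply: computable_half
  | |- computable (fun x => odd _) => apply: computable_odd
  | |- computable (fun x => addn _ _) => apply: computable_add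
  | |- computable (fun x => subn _ _) => apply: computable_sub
  | |- computable (fun x => muln _ _) => apply: computable_mul
  | |- computable (fun x => leq _ _) => apply: computable_leq
  | |- computable (fun x => eq_op _ 0) => apply: computable_eq0
  | |- computable (fun x => iter _ _ _) => apply: computable_iter
  | |- computable (fun x => if _ then _ else _) => apply: computable_if
  end.
Ltac computability := repeat (try eassumption; computability_step).

Lemma computable_app2 {T U V W} {cT : code T} {cU : code U} {cV : code V} {cW : code W}
    (h : U -> V -> W) (f : T -> U) (g : T -> V) :
  computable (fun p : U * V => h p.1 p.2) -> computable f -> computable g ->
  computable (fun x => h (f x) (g x)).
Proof. by move=> Hh Hf Hg; apply: (computable_comp (computable_pair Hf Hg) Hh). Qed.

Section ComputableSeqOps.
Context {T U V : Type} {cT : code T} {cU : code U} {cV : code V}.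

Lemma computable_rev (s : T -> seq U) : computable s -> computable (fun x => rev (s x)).
Proof.
move=> Hs; apply: (eq_computable (f := fun x => foldl (fun l u => u :: l) [::] (s x))).
  by move=> x; rewrite -{1}[s x]revK foldl_rev; elim: (rev (s x)) => //= u l ->.
by computability.
Qed.

Lemma computable_foldr (f : T -> U -> V -> V) (v : T -> V) (s : T -> seq U) :
  computable (fun p : T * V * U => f p.1.1 p.2 p.1.2) -> computable v -> computable s ->
  computable (fun x => foldr (f x) (v x) (s x)).
Proof.
move=> Hf Hv Hs.
apply: (eq_computable (f := fun x => foldl (fun v u => f x u v) (v x) (rev (s x)))).
  by move=> x; rewrite foldl_rev.
by computability; apply: computable_rev.
Qed.

End ComputableSeqOps.

Lemma computable_all {T U} {cT : code T} {cU : code U} (P : T -> U -> bool) (s : T -> seq U) :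
  computable (fun p : T * U => P p.1 p.2) -> computable s ->
  computable (fun x => all (P x) (s x)).
Proof.
move=> HP Hs.
apply: (eq_computable (f := fun x => foldr (fun u b => if P x u then b else false) true (s x))).
  by move=> x; elim: (s x) => //= u l ->; case: (P x u).
apply: computable_foldr => //; computability.
by apply: (computable_app2 HP); computability.
Qed.

Lemma computable_map {T U V} {cT : code T} {cU : code U} {cV : code V}
    (f : T -> U -> V) (s : T -> seq U) :
  computable (fun p : T * U => f p.1 p.2) -> computable s ->
  computable (fun x => map (f x) (s x)).
Proof.
move=> Hf Hs.
apply: (eq_computable (f := fun x => foldr (fun u l => f x u :: l) [::] (s x))).
  by move=> x; elim: (s x) => //= u l ->.
apply: computable_foldr => //; computability.
by apply: (computable_app2 Hf); computability.
Qed.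

(** The quotient is the least [q] with [f x < q.+1 * (g x).+1]; the successor excludes a zero
    divisor. *)
Lemma computable_divS {T} {cT : code T} (f g : T -> nat) :
  computable f -> computable g -> computable (fun x => f x %/ (g x).+1).
Proof.
move=> Hf Hg; apply: (computable_mu (P := fun x q => f x < q.+1 * (g x).+1)).
- by move=> x; rewrite mulSn addnC {1}(divn_eq (f x) (g x).+1) ltn_add2l ltn_mod.
- by move=> x n; rewrite -leqNgt leq_divRL.
- computability; exact: (computable_comp (computable_fst computable_id)).
Qed.

Local Open Scope ring_scope.

(** * Integer and rational arithmetic on codes *)

Definition pos_part (z : int) : nat := if z is Posz n then n else 0%N.
Definition neg_part (z : int) : nat := if z is Negz n then n.+1 else 0%N.

Lemma parts_subz (z : int) : z = (pos_part z)%:Z - (neg_part z)%:Z.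
Proof. by case: z => n; rewrite ?subr0 ?sub0r -?NegzE. Qed.

Lemma parts_abs (z : int) : (pos_part z + neg_part z)%N = `|z|%N.
Proof. by case: z => n; rewrite ?addn0. Qed.

Section ComputableInt.
Context {T : Type} {cT : code T}.

Lemma computable_pos_part (z : T -> int) :
  computable z -> computable (fun x => pos_part (z x)).
Proof.
move=> Hz; have Hc : computable (fun x => enc_int (z x)) by apply: computable_code Hz.
apply: (eq_computable
  (f := fun x => if odd (enc_int (z x)) then 0%N else (enc_int (z x))./2)).
  by move=> x; case: (z x) => n /=; rewrite odd_double ?doubleK.
by computability.
Qed.

Lemma computable_neg_part (z : T -> int) :
  computable z -> computable (fun x => neg_part (z x)).
Proof.
move=> Hz; have Hc : computable (fun x => enc_int (z x)) by apply: computable_code Hz.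
apply: (eq_computable
  (f := fun x => if odd (enc_int (z x)) then (enc_int (z x))./2.+1 else 0%N)).
  by move=> x; case: (z x) => n /=; rewrite odd_double //= uphalf_double.
by computability.
Qed.

Lemma computable_subz (f g : T -> nat) :
  computable f -> computable g -> computable (fun x => (f x)%:Z - (g x)%:Z).
Proof.
(* A natural [n] is coded by [2 * n] and [- n.+1] by [(2 * n).+1], hence the predecessor in the
   negative case. *)
move=> Hf Hg; apply: (computable_code (f := fun x =>
  if (g x <= f x)%N then (2 * (f x - g x))%N else (2 * (g x - f x).-1).+1)); last first.
  by computability.
move=> x; case: leqP => [le_gf | lt_fg]; first by rewrite subzn // mul2n.
by rewrite -opprB subzn 1?ltnW // -{2}(prednK (n := g x - f x)) ?subn_gt0 // -NegzE mul2n.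
Qed.

(** Integers are written as differences of naturals, which leaves arithmetic on naturals and one
    final signed subtraction. *)
Lemma computable_addz (f g : T -> int) :
  computable f -> computable g -> computable (fun x => f x + g x).
Proof.
move=> Hf Hg; apply: (eq_computable (f := fun x =>
  (pos_part (f x) + pos_part (g x))%N%:Z - (neg_part (f x) + neg_part (g x))%N%:Z)).
  by move=> x; rewrite {3}(parts_subz (f x)) {3}(parts_subz (g x)) !PoszD; ring.
by apply: computable_subz; computability;
  try apply: computable_pos_part; try apply: computable_neg_part.
Qed.

Lemma computable_mulz (f g : T -> int) :
  computable f -> computable g -> computable (fun x => f x * g x).
Proof.
move=> Hf Hg; apply: (eq_computable (f := fun x =>
  (pos_part (f x) * pos_part (g x) + neg_part (f x) * neg_part (g x))%N%:Z
  - (pos_part (f x) * neg_part (g x) + neg_part (f x) * pos_part (g x))%N%:Z)).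
  by move=> x; rewrite {5}(parts_subz (f x)) {5}(parts_subz (g x)) !PoszD !PoszM; ring.
by apply: computable_subz; computability;
  try apply: computable_pos_part; try apply: computable_neg_part.
Qed.

Lemma computable_numq (f : T -> rat) : computable f -> computable (fun x => numq (f x)).
Proof.
move=> Hf; apply: (computable_fst (f := fun x => (numq (f x), denq (f x)))).
exact: computable_code Hf.
Qed.

Lemma computable_denq (f : T -> rat) : computable f -> computable (fun x => denq (f x)).
Proof.
move=> Hf; apply: (computable_snd (f := fun x => (numq (f x), denq (f x)))).
exact: computable_code Hf.
Qed.

(* The reduced denominator of a / n.+1 is the least d.+1 such that n.+1 divides a * d.+1. *)
Lemma computable_reduced_denom (f g : T -> nat) :
  computable f -> computable g ->
  computable (fun x => ((g x).+1 %/ gcdn (f x) (g x).+1).-1%N).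
Proof.
move=> Hf Hg.
have dvd_red a N m : (0 < N)%N -> (N %| a * m)%N = (N %/ gcdn a N %| m)%N.
  move=> N0; have g0 : (0 < gcdn a N)%N by rewrite gcdn_gt0 N0 orbT.
  have eN := divnK (dvdn_gcdr a N); have ea := divnK (dvdn_gcdl a N).
  have cop : coprime (N %/ gcdn a N) (a %/ gcdn a N).
    by rewrite /coprime -(eqn_pmul2r g0) mul1n muln_gcdl eN ea gcdnC.
  by rewrite -[X in (X %| _)%N]eN -[X in (_ %| X * _)%N]ea mulnAC dvdn_pmul2r // Gauss_dvdr.
have red0 a n : (0 < n.+1 %/ gcdn a n.+1)%N.
  by rewrite divn_gt0 ?gcdn_gt0 ?orbT // dvdn_leq // dvdn_gcdr.
have modE m d : (m - m %/ d * d = m %% d)%N by rewrite {1}(divn_eq m d) addKn.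
apply: (computable_mu (P := fun x m =>
  f x * m.+1 - (f x * m.+1 %/ (g x).+1) * (g x).+1 == 0)%N).
- by move=> x; rewrite modE -[_ == _]/(_ %| _)%N dvd_red // prednK.
- move=> x m lt_m; rewrite modE -[_ == _]/(_ %| _)%N dvd_red //; apply/negP => /(dvdn_leq (ltn0Sn m)).
  by rewrite ltn_predRL in lt_m; rewrite leqNgt lt_m.
- have Hf1 : computable (fun p : T * nat => f p.1) by apply: computable_comp Hf; computability.
  have Hg1 : computable (fun p : T * nat => g p.1) by apply: computable_comp Hg; computability.
  by computability; apply: computable_divS; computability.
Qed.

(** A rational is coded by its reduced fraction, so the common factor has to be removed on codes. *)
Lemma computable_divq (f : T -> int) (g : T -> nat) :
  computable f -> computable g -> computable (fun x => (f x)%:~R / (g x).+1%:R : rat).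
Proof.
move=> Hf Hg.
pose den x := ((g x).+1 %/ gcdn `|f x| (g x).+1)%N.
(* Both divisions are exact: for [G] the gcd of the absolute value of [f x] and [(g x).+1],
   [den x * G] is [(g x).+1] and [G] divides both parts of [f x]. *)
pose num x := (pos_part (f x) * den x %/ (g x).+1)%N%:Z
              - (neg_part (f x) * den x %/ (g x).+1)%N%:Z.
have abs_comp : computable (fun x => `|f x|%N).
  apply: (eq_computable (f := fun x => (pos_part (f x) + neg_part (f x))%N)).
    by move=> x; exact: parts_abs.
  by computability; [apply: computable_pos_part | apply: computable_neg_part].
have den0 x : (0 < den x)%N.
  by rewrite divn_gt0 ?gcdn_gt0 ?orbT // dvdn_leq // dvdn_gcdr.
have den_comp : computable den.
  apply: (eq_computable (f := fun x => (den x).-1.+1)); first by move=> x; rewrite prednK.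
  by apply/computable_succ/computable_reduced_denom.
have num_comp : computable num.
  apply: computable_subz; apply: computable_divS => //; apply: computable_mul => //.
    exact: computable_pos_part.
  exact: computable_neg_part.
(* Subtracting zero turns the code of a natural number into that of an integer. *)
apply: (computable_code (f := fun x => (num x, (den x)%:Z - 0%N%:Z))); last first.
  by apply: computable_pair => //; apply: computable_subz => //; apply: computable_const.
move=> x; rewrite subr0.
pose G := gcdn `|f x| (g x).+1.
have G0 : (0 < G)%N by rewrite gcdn_gt0 orbT.
have denG : (den x * G)%N = (g x).+1 by rewrite divnK // dvdn_gcdr.
have cancelG a : (G %| a)%N -> (a * den x %/ (g x).+1 * G = a)%N.
  by move=> /dvdnP[b ->]; rewrite -mulnA (mulnC G) denG mulnK.
have Gz : (G %| `|f x|)%N by apply: dvdn_gcdl.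
have numG : num x * G%:Z = f x.
  rewrite /num mulrBl -!PoszM !cancelG -?parts_subz //.
    by case: (f x) Gz.
  by case: (f x) Gz.
have absG : (`|num x| * G)%N = `|f x|%N by rewrite -[RHS](congr1 absz numG) abszM.
have cop : coprime `|num x| `|(den x)%:Z|.
  by rewrite /coprime -(eqn_pmul2r G0) mul1n muln_gcdl absG denG.
have -> : (f x)%:~R / (g x).+1%:R = (num x)%:~R / ((den x)%:Z)%:~R :> rat.
  rewrite -numG -denG natrM rmorphM /= -mulf_div divff ?mulr1 //.
  by rewrite pnatr_eq0 -lt0n.
rewrite [RHS]/encode /code_rat /enc_rat coprimeq_num // coprimeq_den //.
have den_pos : 0 < (den x)%:Z by rewrite ltz_nat.
by rewrite gtr0_sg // mul1r gt_eqF // gtr0_norm.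
Qed.

Lemma computable_addq (f g : T -> rat) :
  computable f -> computable g -> computable (fun x => f x + g x).
Proof.
move=> Hf Hg; pose d x := (pos_part (denq (f x)) * pos_part (denq (g x)))%N.
apply: (eq_computable (f := fun x =>
  (numq (f x) * denq (g x) + numq (g x) * denq (f x))%:~R / (d x).-1.+1%:R)).
  move=> x; have [[m dm] [n dn]] : (exists m, denq (f x) = m.+1) /\ (exists n, denq (g x) = n.+1).
    by split; [case: (denq (f x)) (denq_gt0 (f x)) | case: (denq (g x)) (denq_gt0 (g x))];
      case=> // m _; exists m.
  rewrite /d -[in RHS](divq_num_den (f x)) -[in RHS](divq_num_den (g x)) dm dn.
  rewrite [pos_part m.+1]/= [pos_part n.+1]/= prednK // natrM rmorphD !rmorphM /= -!pmulrn.
  by field; rewrite !nat1r !pnatr_eq0.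
have Hnf := computable_numq Hf; have Hng := computable_numq Hg.
have Hdf := computable_denq Hf; have Hdg := computable_denq Hg.
apply: computable_divq; first by apply: computable_addz; apply: computable_mulz.
by apply/computable_pred/computable_mul; apply: computable_pos_part.
Qed.

Lemma computable_mulq (f g : T -> rat) :
  computable f -> computable g -> computable (fun x => f x * g x).
Proof.
move=> Hf Hg; pose d x := (pos_part (denq (f x)) * pos_part (denq (g x)))%N.
apply: (eq_computable (f := fun x => (numq (f x) * numq (g x))%:~R / (d x).-1.+1%:R)).
  move=> x; have [[m dm] [n dn]] : (exists m, denq (f x) = m.+1) /\ (exists n, denq (g x) = n.+1).
    by split; [case: (denq (f x)) (denq_gt0 (f x)) | case: (denq (g x)) (denq_gt0 (g x))];
      case=> // m _; exists m.
  rewrite /d -[in RHS](divq_num_den (f x)) -[in RHS](divq_num_den (g x)) dm dn.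
  rewrite [pos_part m.+1]/= [pos_part n.+1]/= prednK // natrM rmorphM /= -!pmulrn.
  by field; rewrite !nat1r !pnatr_eq0.
have Hnf := computable_numq Hf; have Hng := computable_numq Hg.
have Hdf := computable_denq Hf; have Hdg := computable_denq Hg.
apply: computable_divq; first by apply: computable_mulz.
by apply/computable_pred/computable_mul; apply: computable_pos_part.
Qed.

Lemma computable_eqq0 (f : T -> rat) : computable f -> computable (fun x => f x == 0).
Proof.
move=> Hf; apply: (eq_computable (f := fun x =>
  (pos_part (numq (f x)) + neg_part (numq (f x)) == 0)%N)).
  by move=> x; rewrite parts_abs absz_eq0 numq_eq0.
have Hn := computable_numq Hf.
by computability; [apply: computable_pos_part | apply: computable_neg_part].
Qed.
End ComputableInt.

Lemma computable_expq {T} {cT : code T} (f : T -> rat) (n : T -> nat) :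
  computable f -> computable n -> computable (fun x => f x ^+ n x).
Proof.
move=> Hf Hn; apply: (eq_computable (f := fun x => iter (n x) (fun r => f x * r) 1)).
  by move=> x; elim: (n x) => //= m ->; rewrite exprS.
computability; apply: computable_mulq; last by computability.
by apply: computable_comp Hf; computability.
Qed.

(** * The augmented loop and its certificates *)

Definition monom (e : seq nat) (x : seq rat) : rat :=
  \prod_(i < size e) nth 0 x i ^+ nth 0%N e i.

Lemma monom_nil x : monom [::] x = 1.
Proof. by rewrite /monom big_ord0. Qed.

Lemma monom_cons n e x : monom (n :: e) x = head 0 x ^+ n * monom e (behead x).
Proof.
rewrite /monom big_ord_recl nth0; congr (_ * _).
by apply: eq_bigr => i _; rewrite nth_behead.
Qed.

(** Indexed access becomes one pass over the exponents that drops an entry of [x] at each step, the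
    form that [computable_foldl] handles. *)
Lemma monom_foldl e x :
  monom e x = (foldl (fun p n => (behead p.1, p.2 * head 0 p.1 ^+ n)) (x, 1) e).2.
Proof.
suff gen a : (foldl (fun p n => (behead p.1, p.2 * head 0 p.1 ^+ n)) (x, a) e).2 = a * monom e x.
  by rewrite gen mul1r.
elim: e x a => [|n e IH] x a /=; first by rewrite monom_nil mulr1.
by rewrite IH monom_cons mulrA.
Qed.

Lemma computable_monom {T} {cT : code T} (e : T -> seq nat) (x : T -> seq rat) :
  computable e -> computable x -> computable (fun t => monom (e t) (x t)).
Proof.
move=> He Hx; apply: (eq_computable (f := fun t =>
  (foldl (fun p n => (behead p.1, p.2 * head 0 p.1 ^+ n)) (x t, 1) (e t)).2)).
  by move=> t; rewrite monom_foldl.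
by computability; apply: computable_mulq; computability; apply: computable_expq; computability.
Qed.

Lemma eval_qpolyE P x : eval_qpoly P x = \sum_(m <- P) m.1 * monom m.2 x.
Proof. by []. Qed.

Lemma computable_eval_qpoly {T} {cT : code T} (P : T -> qpoly) (x : T -> seq rat) :
  computable P -> computable x -> computable (fun t => eval_qpoly (P t) (x t)).
Proof.
move=> HP Hx; apply: (eq_computable (f := fun t =>
  foldr (fun m r => m.1 * monom m.2 (x t) + r) 0 (P t))).
  by move=> t; rewrite /eval_qpoly; elim: (P t) => [|m l IH] /=; rewrite ?big_nil // big_cons IH.
apply: computable_foldr; computability.
apply: computable_addq; computability; apply: computable_mulq; computability.
apply: computable_monom; computability.
by apply: computable_comp Hx; computability.
Qed.

Lemma computable_step {T} {cT : code T} (ps : T -> seq qpoly) (x : T -> seq rat) :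
  computable ps -> computable x -> computable (fun t => step (ps t) (x t)).
Proof.
move=> Hps Hx; apply: computable_map; computability.
by apply: computable_eval_qpoly; computability; apply: computable_comp Hx; computability.
Qed.

(** * Adjoining the variable [y], and the squared distance to the target *)

Definition add_var (c : nat) (P : qpoly) : qpoly := [seq (m.1, c :: m.2) | m <- P].

Lemma computable_add_var {T} {cT : code T} c (P : T -> qpoly) :
  computable P -> computable (fun t => add_var c (P t)).
Proof. by move=> HP; apply: computable_map; computability. Qed.

Lemma eval_add_var c P x :
  eval_qpoly (add_var c P) x = head 0 x ^+ c * eval_qpoly P (behead x).
Proof.
rewrite !eval_qpolyE big_map big_distrr; apply: eq_bigr => m _.
by rewrite monom_cons mulrCA.
Qed.

Lemma add_var_wf c k P : qpoly_wf k P -> qpoly_wf k.+1 (add_var c P).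
Proof. by rewrite /qpoly_wf all_map; apply: sub_all => m. Qed.

(* First component: the zero exponent vector; second: sum_i (x_i - t_i)^2, expanded. *)
Definition sqdist_rec (t : seq rat) : seq nat * qpoly :=
  foldr (fun a p => (0%N :: p.1,
    [:: (1, 2%N :: p.1), (- 2 * a, 1%N :: p.1), (a * a, 0%N :: p.1) & add_var 0 p.2]))
    ([::], [::]) t.

Definition sqdist (t : seq rat) : qpoly := (sqdist_rec t).2.

Lemma computable_sqdist {T} {cT : code T} (t : T -> seq rat) :
  computable t -> computable (fun x => sqdist (t x)).
Proof.
move=> Ht; apply/computable_snd/computable_foldr; computability.
- by apply: computable_mulq; computability.
- by apply: computable_mulq; computability.
- by apply: computable_add_var; computability.
Qed.

Lemma sqdist_rec1 t : (sqdist_rec t).1 = nseq (size t) 0%N.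
Proof. by elim: t => //= a t ->. Qed.

Lemma sqdist_wf t : qpoly_wf (size t) (sqdist t).
Proof.
rewrite /sqdist; elim: t => //= a t IH.
by rewrite !sqdist_rec1 size_nseq eqxx /=; apply: add_var_wf.
Qed.

Lemma monom_nseq0 n x : monom (nseq n 0%N) x = 1.
Proof. by elim: n x => [|n IH] x /=; rewrite ?monom_nil // monom_cons IH mulr1. Qed.

Lemma eval_cons m P x : eval_qpoly (m :: P) x = m.1 * monom m.2 x + eval_qpoly P x.
Proof. by rewrite /eval_qpoly big_cons. Qed.

Lemma eval_sqdist t x :
  eval_qpoly (sqdist t) x = \sum_(i < size t) (nth 0 x i - nth 0 t i) ^+ 2.
Proof.
rewrite /sqdist; elim: t x => [|a t IH] x /=; first by rewrite big_ord0 /eval_qpoly big_nil.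
rewrite !eval_cons eval_add_var IH sqdist_rec1 /= !monom_cons !monom_nseq0 big_ord_recl /= nth0.
under [in RHS]eq_bigr => i _ do rewrite -nth_behead.
by ring.
Qed.

(** Squares of rationals are nonnegative, so one polynomial equation expresses equality with the
    whole target vector. *)
Lemma eval_sqdist_eq0 t x : size x = size t -> (eval_qpoly (sqdist t) x == 0) = (x == t).
Proof.
move=> sz; rewrite eval_sqdist psumr_eq0 => [|i _]; last exact: sqr_ge0.
apply/allP/eqP => [H|-> i _]; last by rewrite subrr expr0n.
apply: (eq_from_nth (x0 := 0)) => // i; rewrite sz => lt_i.
have := H (Ordinal lt_i) (mem_index_enum _); rewrite sqrf_eq0 subr_eq0.
by move/eqP.
Qed.

(** A nested product in the order of the fields, so that the product instances give the same code as
    [enc_p2p]. *)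
Definition inst := (nat * (seq qpoly * (seq rat * seq rat)))%type.

Definition watch_upd (I : inst) : seq qpoly :=
  add_var 1 (sqdist I.2.2.2) :: map (add_var 0) I.2.1.

Definition watch_state (I : inst) (n : nat) : seq rat :=
  iter n (step (watch_upd I)) (1 :: I.2.2.1).

Lemma computable_watch_upd {T} {cT : code T} (I : T -> inst) :
  computable I -> computable (fun x => watch_upd (I x)).
Proof.
move=> HI; rewrite /watch_upd; computability; first by apply/computable_add_var/computable_sqdist; computability.
by apply: computable_map; computability; apply: computable_add_var; computability.
Qed.

Lemma computable_watch_state {T} {cT : code T} (I : T -> inst) (n : T -> nat) :
  computable I -> computable n -> computable (fun x => watch_state (I x) (n x)).
Proof.
move=> HI Hn; rewrite /watch_state; computability; apply: computable_step; computability.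
by apply: computable_watch_upd; apply: computable_comp HI; computability.
Qed.

(** * Surjectivity of the codings, and decoders *)

Lemma pairn_surj n : (0 < n)%N -> exists a b, n = pairn a b.
Proof.
elim/ltn_ind: n => n IH n0; have := odd_double_half n; case: odd => /= nE.
  by exists 0%N, n./2; rewrite /pairn mul1n -{1}nE.
have [||a [b hE]] := IH n./2; last 1 first.
- by exists a.+1, b; rewrite /pairn expnS -mulnA -/(pairn a b) -hE mul2n -{1}nE.
- by rewrite -{2}nE -addnn -{1}[n./2]addn0 ltn_add2l; move: n0; rewrite -nE; case: n./2.
- by move: n0; rewrite -nE; case: n./2.
Qed.

Lemma enc_list_surj n : exists s, enc_list s == n.
Proof.
elim/ltn_ind: n => -[|n] IH; first by exists [::].
have [//|a [b nE]] := @pairn_surj n.+1.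
have [|s /eqP sE] := IH b; first by rewrite nE ltn_pairn.
by exists (a :: s); rewrite /= sE nE.
Qed.

Definition dec_list (n : nat) : seq nat := xchoose (enc_list_surj n).

Lemma dec_listK n : enc_list (dec_list n) = n.
Proof. exact/eqP/(xchooseP (enc_list_surj n)). Qed.

Lemma enc_list_inj : injective enc_list.
Proof.
have pairn_inj a b c d : pairn a b = pairn c d -> (a, b) = (c, d).
  move=> E; have := congr1 odd_part E; rewrite !odd_part_pairn => -[] /double_inj bd.
  move: E; rewrite bd => /eqP; rewrite /pairn eqn_pmul2r // eqn_exp2l // => /eqP -> //.
elim=> [|x s IH] [|y t] //= E.
- by have := pairn_gt0 y (enc_list t); rewrite -E.
- by have := pairn_gt0 x (enc_list s); rewrite E.
- by have [-> /IH ->] := pairn_inj _ _ _ _ E.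
Qed.

Lemma enc_listK s : dec_list (enc_list s) = s.
Proof. by apply: enc_list_inj; rewrite dec_listK. Qed.

(** The code of [dec_list n] is [n], so decoding costs nothing. *)
Lemma computable_dec_list {T} {cT : code T} (f : T -> nat) :
  computable f -> computable (fun x => dec_list (f x)).
Proof.
move=> Hf; apply: computable_code Hf => x.
by rewrite [RHS]/encode /code_seq map_id dec_listK.
Qed.

Definition dec_int (n : nat) : int := if odd n then Negz n./2 else Posz n./2.

Lemma dec_intK n : enc_int (dec_int n) = n.
Proof. by have := odd_double_half n; rewrite /dec_int; case: odd. Qed.

Lemma enc_intK z : dec_int (enc_int z) = z.
Proof. by case: z => n; rewrite /dec_int /= odd_double /= ?doubleK ?uphalf_double. Qed.

Lemma computable_dec_int {T} {cT : code T} (f : T -> nat) :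
  computable f -> computable (fun x => dec_int (f x)).
Proof. by move=> Hf; apply: computable_code Hf => x; rewrite [RHS]/encode /code_int dec_intK. Qed.

(** Not an inverse of [enc_rat] but a total surjection: missing entries default to 0 and the
    denominator is a successor, so any number may serve as a coefficient. *)
Definition dec_rat (n : nat) : rat :=
  let s := dec_list n in (dec_int (head 0%N s))%:~R / (head 0%N (behead s)).+1%:R.

Lemma dec_rat_surj q : exists n, dec_rat n = q.
Proof.
exists (enc_list [:: enc_int (numq q); `|denq q|.-1]).
rewrite /dec_rat enc_listK /= enc_intK prednK ?absz_gt0 ?denq_neq0 //.
by rewrite -[in RHS](divq_num_den q) pmulrn absz_denq.
Qed.

Lemma computable_dec_rat {T} {cT : code T} (f : T -> nat) :
  computable f -> computable (fun x => dec_rat (f x)).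
Proof.
move=> /computable_dec_list Hf; apply: computable_divq; last by computability.
by apply: computable_dec_int; computability.
Qed.

(** The fold carries the orbit along with the partial sum, starting one step after [s]. The
    coefficient at [s] is normalised to 1, so a zero expresses the monomial at [s] through its later
    values. *)
Definition lincomb (ps : seq qpoly) (ws : seq nat) (s : seq rat) (e : seq nat) : rat :=
  (foldl (fun p w => (step ps p.1, p.2 + dec_rat w * monom e p.1))
     (step ps s, monom e s) ws).2.

Lemma lincombE ps ws s e : lincomb ps ws s e =
  monom e s + \sum_(j < size ws) dec_rat (nth 0%N ws j) * monom e (iter j.+1 (step ps) s).
Proof.
rewrite /lincomb; move: (monom e s) => a; under eq_bigr => j _ do rewrite iterSr.
move: (step ps s) => x; elim: ws x a => [|w ws IH] x a /=.
  by rewrite big_ord0 addr0.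
rewrite IH big_ord_recl /= addrA; congr (_ + _).
by apply: eq_bigr => j _; rewrite -iterS iterSr.
Qed.

Lemma computable_lincomb {T} {cT : code T} (ps : T -> seq qpoly) (ws : T -> seq nat)
    (s : T -> seq rat) (e : T -> seq nat) :
  computable ps -> computable ws -> computable s -> computable e ->
  computable (fun x => lincomb (ps x) (ws x) (s x) (e x)).
Proof.
move=> Hps Hws Hs He; apply: computable_snd; computability.
- by apply: computable_step; computability; apply: computable_comp Hps; computability.
- apply: computable_addq; computability; apply: computable_mulq.
    by apply: computable_dec_rat; computability.
  by apply: computable_monom; computability; apply: computable_comp He; computability.
- exact: computable_step.
- exact: computable_monom.
Qed.

(* [enc_list] is a bijection, so every number is a certificate: a time, followed by codes of
   the rational coefficients of a linear relation. *)
Definition cert_time (n : nat) : nat := head 0%N (dec_list n).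
Definition cert_coefs (n : nat) : seq nat := behead (dec_list n).

Definition cert_reached (I : inst) (n : nat) : bool :=
  head 0 (watch_state I (cert_time n).+1) == 0.

(** The loop starts one step after [t], so the tail does not include time [t] itself; the extra
    dimension is that of [y]. *)
Definition tail_query (I : inst) (t : nat) : nat * (seq qpoly * seq rat) :=
  (I.1.+1, (watch_upd I, watch_state I t.+1)).

(** The coefficients, of type [X], are never inspected: a relation valid for each monomial passes to
    all their combinations. A hit validates at once, so a single search covers both outcomes. *)
Definition cert_valid {X} (I : inst) (n : nat) (A : seq (seq (X * seq nat))) : bool :=
  if cert_reached I n then true else
  all (fun P => all (fun m =>
    lincomb (watch_upd I) (cert_coefs n) (watch_state I (cert_time n)) m.2 == 0) P) A.

Lemma computable_cert_reached : computable (fun p : inst * nat => cert_reached p.1 p.2).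
Proof.
rewrite /cert_reached /cert_time.
apply/computable_eqq0/computable_head/computable_watch_state; computability.
by apply: computable_dec_list; computability.
Qed.

Lemma computable_tail_query :
  computable (fun p : inst * nat => tail_query p.1 (cert_time p.2)).
Proof.
rewrite /tail_query /cert_time; computability.
  by apply: computable_watch_upd; computability.
apply: computable_watch_state; computability.
by apply: computable_dec_list; computability.
Qed.

Lemma computable_cert_valid {X} {cX : code X} :
  computable (fun p : inst * nat * seq (seq (X * seq nat)) => cert_valid p.1.1 p.1.2 p.2).
Proof.
apply: computable_if; computability.
  by apply: (computable_comp _ computable_cert_reached); computability.
do 2 (apply: computable_all; computability).
apply/computable_eqq0/computable_lincomb; computability.
- by apply: computable_watch_upd; computability.
- by apply/computable_behead/computable_dec_list; computability.
- apply: computable_watch_state; computability.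
  by apply/computable_head/computable_dec_list; computability.
Qed.

(** Unbounded search with one oracle call per candidate, after which [cert_reached] is evaluated
    once more to tell the two kinds of success apart. *)
Lemma oracle_search {X} {cX : code X} :
  exists e, forall O (I : inst) (A : nat -> seq (seq (X * seq nat))) n,
    (forall m, O (encode (tail_query I (cert_time m))) = encode (A m)) ->
    cert_valid I n (A n) ->
    (forall m, (m < n)%N -> ~~ cert_valid I m (A m)) ->
    eval O e [:: encode I] (cert_reached I n).
Proof.
have [pq Hq] := computable_tail_query.
have [pv Hv] := @computable_cert_valid X cX.
have [pr Hr] := computable_cert_reached.
have [r pair_r] := pairn_rec.
have [q Hsub] := total_rec_sub (total_rec_const 1 1) (total_rec_nth 1 0).
pose pIn := PComp r [:: PProj 1; PProj 0].
(* Subtraction from 1 makes validity the value 0 at which [PMu] stops. *)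
pose body := PComp q [:: PComp pv [:: PComp r [:: pIn; PComp POrc [:: PComp pq [:: pIn]]]]].
exists (PComp pr [:: PComp r [:: PProj 0; PMu body]]) => O I A n OA val_n min_n.
have eval_pIn m : eval O pIn [:: m; encode I] (encode (I, m)).
  by apply: eComp; [apply: evals2; apply: eProj | apply: pair_r].
have eval_body m : eval O body [:: m; encode I] (1 - cert_valid I m (A m)).
  apply: eComp; last exact: (Hsub O [:: _]).
  apply/evals1/eComp; last exact: (Hv O ((I, m), A m)).
  apply/evals1/eComp; last exact: pair_r.
  apply: evals2; first exact: eval_pIn.
  rewrite -OA; apply: (@eComp _ _ _ _ [:: _]); last exact: eOrc.
  by apply/evals1/eComp; [apply/evals1/eval_pIn | apply: (Hq O (I, m))].
apply: eComp; last exact: (Hr O (I, n)).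
apply/evals1/eComp; last exact: pair_r.
apply: evals2; first exact: eProj.
apply: eMu; first by have := eval_body n; rewrite val_n.
by move=> m /min_n nv; exists 0%N; have := eval_body m; rewrite (negbTE nv).
Qed.

(** * Linear algebra and Noetherianity *)

Section SpanSeparation.
Variables (F : fieldType) (e : nat) (v : nat -> 'rV[F]_e).

Definition first_rows (J : nat) : 'M[F]_(J, e) := \matrix_(j < J) v j.

Lemma first_rows_sub J K : (J <= K)%N -> (first_rows J <= first_rows K)%MS.
Proof.
move=> le_JK; apply/row_subP => i; rewrite rowK.
by have := row_sub (widen_ord le_JK i) (first_rows K); rewrite rowK.
Qed.

(** As long as some vector lies outside the span, adding it raises the rank, which cannot exceed the
    number [e] of columns. *)
Lemma first_rows_span : exists J, forall j, (v j <= first_rows J)%MS.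
Proof.
have gen r : (exists J, forall j, (v j <= first_rows J)%MS) \/
             (exists J, r <= \rank (first_rows J))%N.
  elim: r => [|r [|[J rJ]]]; [by right; exists 0%N | by left |].
  have [sub|/not_all_ex_not[j /negP nsub]] := classic (forall j, (v j <= first_rows J)%MS).
    by left; exists J.
  right; exists (maxn J j.+1); apply: leq_ltn_trans rJ _; apply: rank_ltmx.
  rewrite /ltmx first_rows_sub ?leq_maxl //=; apply: contra nsub; apply: submx_trans.
  have lt_j : (j < maxn J j.+1)%N by rewrite leq_maxr.
  by have := row_sub (Ordinal lt_j) (first_rows (maxn J j.+1)); rewrite rowK.
have [//|[J]] := gen e.+1.
by rewrite ltnNge rank_leq_col.
Qed.

(** For a vector outside the span, some column of the cokernel matrix kills the spanning rows but
    not that vector. On monomial vectors, such a functional is a polynomial vanishing on a tail but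
    not at the earlier state. *)
Lemma span_or_separate (u : 'rV[F]_e) :
  (exists ws : seq F, u + \sum_(j < size ws) nth 0 ws j *: v j = 0) \/
  (exists c : 'cV[F]_e, (forall j, v j *m c = 0) /\ u *m c != 0).
Proof.
have [J spanJ] := first_rows_span; have [|nsub] := boolP (u <= first_rows J)%MS.
  move=> /submxP[D uD]; left; exists (mkseq (fun j => if insub j is Some i then - D 0 i else 0) J).
  rewrite size_mkseq uD mulmx_sum_row -big_split /=; apply: big1 => j _.
  by rewrite nth_mkseq // rowK valK scaleNr addrN.
right; have [j nz] : exists j, (u *m cokermx (first_rows J)) 0 j != 0.
  apply/existsP; apply: contraNT nsub => /existsPn nz; rewrite submxE.
  by apply/eqP/rowP => j; rewrite [RHS]mxE; apply/eqP/negbNE/nz.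
exists (col j (cokermx (first_rows J))); split=> [i|].
  by rewrite colE mulmxA; have := spanJ i; rewrite submxE => /eqP->; rewrite mul0mx.
by apply: contraNneq nz => /colP/(_ 0); rewrite colE mulmxA -colE mxE => ->; rewrite mxE.
Qed.

End SpanSeparation.

(** * Dickson's lemma and limit points of sequences *)

Lemma nondecreasing_subseq (u : nat -> nat) :
  exists phi : nat -> nat, {homo phi : i j / (i < j)%N} /\ {homo u \o phi : i j / (i <= j)%N}.
Proof.
have argmin n : exists j, (n < j)%N /\ forall i, (n < i)%N -> (u j <= u i)%N.
  have [m [j [nj uj]] min] : exists2 m, (exists j, (n < j)%N /\ u j = m) &
      forall j, (n < j)%N -> (m <= u j)%N.
    apply: NNPP => none.
    have none' m : ~ exists j, (n < j)%N /\ u j = m.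
      elim/ltn_ind: m => m IH ex; apply: none; exists m => // j nj.
      by rewrite leqNgt; apply/negP => /IH; apply; exists j.
    by apply: (none' (u n.+1)); exists n.+1.
  by exists j; split=> // i /min; rewrite uj.
(* [nxt n] is a position beyond [n] where [u] is minimal. Iterating from [nxt 0] rather than 0 makes
   every term of the subsequence such a minimum, hence no larger than the next. *)
pose nxt n := proj1_sig (constructive_indefinite_description _ (argmin n)).
have nxtP n : (n < nxt n)%N /\ forall i, (n < i)%N -> (u (nxt n) <= u i)%N.
  exact: proj2_sig (constructive_indefinite_description _ (argmin n)).
pose phi i := iter i.+1 nxt 0%N.
have phiS i : (phi i < phi i.+1)%N by have [] := nxtP (phi i).
exists phi; split; first by apply: homo_ltn => //; apply: ltn_trans.
apply: homo_leq => [//| |i]; first by move=> ???; apply: leq_trans.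
have [_] := nxtP (iter i nxt 0%N); apply; apply: ltn_trans (phiS i).
by have [] := nxtP (iter i nxt 0%N).
Qed.

(** Passing to subsequences one coordinate at a time makes all [d] exponents nondecreasing, so that
    already the first two terms are comparable. *)
Lemma dickson d (m : nat -> 'X_{1..d}) : exists i j, (i < j)%N /\ (m i <= m j)%MM.
Proof.
have mono_subseq c : exists phi : nat -> nat, {homo phi : i j / (i < j)%N} /\
    forall l : 'I_d, (l < c)%N -> {homo (fun i => m (phi i) l) : i j / (i <= j)%N}.
  elim: c => [|c [phi [inc mono]]]; first by exists id; split=> [i j //|l].
  have [lt_cd|le_dc] := ltnP c d; last first.
    exists phi; split=> // l _; apply: mono; exact: leq_trans (ltn_ord l) le_dc.
  have [psi [psi_inc psi_mono]] := nondecreasing_subseq (fun i => m (phi i) (Ordinal lt_cd)).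
  exists (phi \o psi); split=> [i j ij|l]; first by apply/inc/psi_inc.
  rewrite ltnS leq_eqVlt => /predU1P[lc|lt_lc] i j ij.
    by have -> : l = Ordinal lt_cd by [apply/val_inj]; apply: psi_mono.
  apply: (mono l lt_lc); move: ij; rewrite leq_eqVlt => /predU1P[->//|/psi_inc/ltnW//].
have [phi [phi_inc phi_mono]] := mono_subseq d.
exists (phi 0%N), (phi 1%N); split; first exact: phi_inc.
by apply/mnm_lepP => l; apply: (phi_mono l (ltn_ord l)).
Qed.

(* A sequence separated from its tails at every time would give, by minimal leading
   monomials and Dickson's lemma, a polynomial that can be reduced further. *)
Lemma limit_point (F : fieldType) d (s : nat -> 'I_d -> F) :
  exists m, forall p : {mpoly F[d]},
    (forall j, (m < j)%N -> meval (s j) p = 0) -> meval (s m) p = 0.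
Proof.
apply: NNPP => none.
pose sep m (p : {mpoly F[d]}) := (forall j, (m < j)%N -> meval (s j) p = 0) /\ meval (s m) p <> 0.
have ex_sep m : exists p, sep m p /\ forall q, sep m q -> (mlead p <= mlead q)%O.
  have [p sep_p] : exists p, sep m p.
    have /not_all_ex_not[p np] := not_ex_all_not _ _ none m.
    by exists p; exact: (imply_to_and _ _ np).
  apply: NNPP => nomin; have nosep (l : 'X_{1..d}) : forall q, sep m q -> mlead q <> l.
    move: l; apply: ltmwf => l IH q sep_q ql; apply: nomin; exists q; split=> // r sep_r.
    by rewrite leNgt; apply/negP => lt_rq; apply: (IH (mlead r)) sep_r _; rewrite -?ql.
  exact: nosep sep_p erefl.
pose f m := proj1_sig (constructive_indefinite_description _ (ex_sep m)).
have fP m : sep m (f m) /\ forall q, sep m q -> (mlead (f m) <= mlead q)%O.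
  exact: proj2_sig (constructive_indefinite_description _ (ex_sep m)).
have f_neq0 m : f m != 0.
  by apply/eqP => f0; have [[_]] := fP m; rewrite f0 meval0.
have [i [j [lt_ij div_ij]]] := dickson (fun m => mlead (f m)).
have [[fi0 _] _] := fP i; have [[fj0 fjj] min_j] := fP j.
(* A multiple of [f i] with the leading term of [f j]. It vanishes after time [i], hence at [j] and
   later, so [f j - h] still separates [j] from its tail. Minimality forces its leading monomial to
   be that of [f j], whose coefficient has cancelled. *)
pose h := (mleadc (f j) / mleadc (f i)) *: ('X_[mlead (f j) - mlead (f i)] * f i).
have lci : mleadc (f i) != 0 by rewrite mleadc_eq0.
have lcj : mleadc (f j) != 0 by rewrite mleadc_eq0.
have lead_h : (mlead ('X_[mlead (f j) - mlead (f i)] * f i) <= mlead (f j))%O.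
  by apply: le_trans (mleadM_le _ _) _; rewrite mleadXm submK.
have coef_h : h@_(mlead (f j)) = mleadc (f j).
  have coefX l : ('X_[l] * f i)@_(l + mlead (f i)) = mleadc (f i) by rewrite mulrC mcoeffMX.
  by have := coefX (mlead (f j) - mlead (f i))%MM; rewrite submK // mcoeffZ => ->; rewrite mulfVK.
pose g := f j - h.
have sep_g : sep j g.
  split=> [k lt_jk|]; rewrite mevalB mevalZ mevalM fi0 ?mulr0 ?subr0 //.
    exact: fj0.
  exact: ltn_trans lt_jk.
have g_neq0 : g != 0 by apply/eqP => g0; have [_] := sep_g; rewrite g0 meval0.
have lead_g : mlead g = mlead (f j).
  apply/le_anti; rewrite min_j // andbT; apply: le_trans (mleadB_le _ _) _.
  by rewrite leUx lexx /=; apply: le_trans (mleadZ_le _ _) lead_h.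
by move: g_neq0; rewrite -mleadc_eq0 lead_g mcoeffB coef_h subrr eqxx.
Qed.

(** * Correctness of the search *)

Lemma encode_seq_nat (s : seq nat) : encode s = enc_list s.
Proof. by rewrite /encode /code_seq map_id. Qed.

Lemma encode_qpoly (P : qpoly) : encode P = enc_qpoly P.
Proof.
congr enc_list; apply: eq_map => m.
by rewrite /encode /code_prod encode_seq_nat.
Qed.

Lemma encode_qpolys (ps : seq qpoly) : encode ps = enc_list (map enc_qpoly ps).
Proof. by congr enc_list; apply: eq_map => P; rewrite encode_qpoly. Qed.

Definition inst_of (I : p2p_inst) : inst :=
  (p2p_k I, (p2p_polys I, (p2p_init I, p2p_target I))).

Lemma encode_inst I : encode (inst_of I) = enc_p2p I.
Proof. by rewrite /enc_p2p -encode_qpolys. Qed.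

Definition query_loop (I : inst) (t : nat) : loop :=
  Loop (tail_query I t).1 (tail_query I t).2.1 (tail_query I t).2.2.

Lemma encode_query I n : encode (tail_query I n) = enc_loop (query_loop I n).
Proof. by rewrite /enc_loop -encode_qpolys. Qed.

#[export] Instance code_algcode : code algcode | 0 := enc_algcode.

Lemma encode_basis (A : seq (seq (algcode * seq nat))) :
  encode A = enc_basis A.
Proof.
congr enc_list; apply: eq_map => P; congr enc_list; apply: eq_map => m.
by rewrite /encode /code_prod encode_seq_nat.
Qed.

(** The ring is a parameter because certificates are found over [rat], while the ideals of the
    oracle live over [algC]. *)
Definition point (K : unitRingType) d (s : seq rat) : 'I_d -> K := fun i => ratr (nth 0 s i).

Lemma meval_monom (K : numFieldType) d e (s : seq rat) : size e = d ->
  meval (@point K d s) 'X_[mnm_of d e] = ratr (monom e s).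
Proof.
move=> <-; rewrite mevalX /monom rmorph_prod; apply: eq_bigr => i _.
by rewrite mnmE rmorphXn.
Qed.

Lemma mem_ideal_gen d (B : seq {mpoly algC[d]}) j : (j < size B)%N -> in_ideal_gen B B`_j.
Proof.
move=> lt_j; exists (mkseq (fun i => (i == j)%:R) (size B)); split; first exact: size_mkseq.
rewrite (bigD1 (Ordinal lt_j)) //= nth_mkseq // eqxx mul1r big1 ?addr0 // => i ne_ij.
by rewrite nth_mkseq // -[i == j :> nat]/(i == Ordinal lt_j) (negbTE ne_ij) mul0r.
Qed.

Definition sqdist_mpoly d (a : seq rat) : {mpoly algC[d]} :=
  \sum_(i < d) ('X_i - (ratr (nth 0 a i))%:MP) ^+ 2.

(** Over [algC] sums of squares may have further zeros; evaluation at a rational point brings the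
    claim back to [rat]. *)
Lemma meval_sqdist_mpoly d (a b : seq rat) : size a = d -> size b = d ->
  (meval (@point algC d b) (sqdist_mpoly d a) == 0) = (b == a).
Proof.
move=> sza szb; rewrite -eval_sqdist_eq0 ?szb // eval_sqdist sza raddf_sum /=.
rewrite -(fmorph_eq0 (ratr : rat -> algC)) rmorph_sum /=; congr (_ == _).
by apply: eq_bigr => i _; rewrite rmorphXn rmorphB /= mevalXU mevalC rmorphXn rmorphB.
Qed.

Lemma apoly_den_size d (P : apoly) (q : {mpoly algC[d]}) m :
  apoly_den P q -> m \in P -> size m.2 = d.
Proof.
elim: P q => //= -[c e] P IH q [z [q' [sz _ Pq' _]]].
by rewrite inE => /predU1P[->//|]; apply: IH Pq'.
Qed.

Section Watch.
Variable I : p2p_inst.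
Hypothesis wfI : p2p_wf I.

Local Notation J := (inst_of I).
Local Notation k := (p2p_k I).
Local Notation s := (watch_state J).
Local Notation x n := (iter n (step (p2p_polys I)) (p2p_init I)).

Lemma behead_watch n : behead (s n) = x n.
Proof.
elim: n => //= n <-; rewrite /step -map_comp; apply: eq_map => P /=.
by rewrite eval_add_var mul1r.
Qed.

Lemma size_traj n : size (x n) = k.
Proof. by case: wfI => _ sz _ szi _; case: n => //= n; rewrite size_map. Qed.

Lemma size_watch n : size (s n) = k.+1.
Proof.
case: wfI => _ sz _ szi _; case: n => [|n] /=; first by rewrite szi.
by rewrite !size_map sz.
Qed.

Lemma head_watchS n : head 0 (s n.+1) = head 0 (s n) * eval_qpoly (sqdist (p2p_target I)) (x n).
Proof. by rewrite /= eval_add_var behead_watch. Qed.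

(** [y] starts at 1 and is then the product of the squared distances to the target at all earlier
    times. *)
Lemma head_watch_eq0 n : head 0 (s n) = 0 <-> exists2 m, (m < n)%N & x m = p2p_target I.
Proof.
have szt : size (p2p_target I) = k by case: wfI.
elim: n => [|n IH]; first by split=> [/eqP|[]//]; rewrite oner_eq0.
rewrite head_watchS; split=> [/eqP|[m]].
  rewrite mulf_eq0 => /orP[/eqP/IH[m mn xm]|]; first by exists m => //; apply: ltnW.
  by rewrite eval_sqdist_eq0 ?size_traj // => /eqP xn; exists n.
rewrite ltnS leq_eqVlt => /predU1P[->|mn] xm; apply/eqP; rewrite mulf_eq0.
  by rewrite eval_sqdist_eq0 ?size_traj // xm eqxx orbT.
by apply/orP; left; apply/eqP/IH; exists m.
Qed.

Lemma iter_watch m n : iter n (step (watch_upd J)) (s m) = s (n + m).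
Proof. by rewrite /watch_state iterD. Qed.

Lemma query_loop_wf n : loop_wf (query_loop J n).
Proof.
case: wfI => _ sz wfp szi szt; split; last exact: size_watch.
  by rewrite /= size_map sz.
rewrite /= -szt (add_var_wf _ (sqdist_wf _)) /= all_map szt.
by apply: sub_all wfp => P; apply: add_var_wf.
Qed.

Lemma query_loop_state t l :
  @loop_state (query_loop J t) l = @point algC k.+1 (s (l + t.+1)).
Proof. by rewrite -iter_watch. Qed.

(** Take [t] from [limit_point]. Were the monomial vector at [t] no combination of later ones, the
    separating functional would be a polynomial vanishing on the tail but not at [t]. Working over
    [rat] makes the coefficients codable. *)
Lemma cert_exists (A : nat -> seq apoly) :
  (forall t P m, P \in A t -> m \in P -> size m.2 = k.+1) ->
  exists n, cert_valid J n (A (cert_time n)).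
Proof.
move=> sizeA; have [t lim] := limit_point (fun j => @point rat k.+1 (s j)).
pose E := flatten [seq [seq m.2 | m <- P] | P <- A t].
have sizeE e : e \in E -> size e = k.+1.
  by move=> /flatten_mapP[P PA /mapP[m mP ->]]; apply: sizeA PA mP.
pose v n := \row_(i < size E) monom (nth [::] E i) (s n).
have [[ws rel]|[c [cv cu]]] := span_or_separate (fun j => v (j.+1 + t)%N) (v t).
  have ex_code q : exists n, dec_rat n == q by have [n <-] := dec_rat_surj q; exists n.
  pose cs := [seq xchoose (ex_code q) | q <- ws].
  exists (enc_list (t :: cs)).
  rewrite /cert_valid /cert_reached /cert_time /cert_coefs enc_listK; case: ifP => //= _.
  apply/allP => P PA; apply/allP => m mP; rewrite lincombE.
  have mE : m.2 \in E by apply/flatten_mapP; exists P => //; apply: map_f.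
  have lt_i : (index m.2 E < size E)%N by rewrite index_mem.
  apply/eqP; move/rowP/(_ (Ordinal lt_i)): rel.
  rewrite !mxE summxE /= nth_index // size_map => rel; rewrite -[RHS]rel; congr (_ + _).
  apply: eq_bigr => j _; rewrite !mxE /= nth_index // iter_watch (nth_map 0) //.
  by rewrite (eqP (xchooseP (ex_code _))).
pose p := \sum_(i < size E) c i 0 *: 'X_[mnm_of k.+1 (nth [::] E i)] : {mpoly rat[k.+1]}.
have ratr_rat (q : rat) : ratr q = q by rewrite /ratr divq_num_den.
have evalp n : meval (@point rat k.+1 (s n)) p = (v n *m c) 0 0.
  rewrite /p mxE raddf_sum /=; apply: eq_bigr => i _.
  by rewrite mevalZ meval_monom ?sizeE ?mem_nth // ratr_rat mxE mulrC.
case/negP: cu; apply/eqP/matrixP => i j; rewrite !ord1 [RHS]mxE -evalp.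
by apply: lim => l lt_tl; rewrite evalp -(subnK lt_tl) -addSnnS cv mxE.
Qed.

(** By linearity: the relation holds for each monomial of [q], and the algebraic coefficients factor
    out. *)
Lemma apoly_den_lincomb t cs P (q : {mpoly algC[k.+1]}) :
  apoly_den P q -> all (fun m => lincomb (watch_upd J) cs (s t) m.2 == 0) P ->
  meval (@point algC k.+1 (s t)) q + \sum_(j < size cs)
    ratr (dec_rat (nth 0%N cs j)) * meval (@point algC k.+1 (s (j.+1 + t))) q = 0.
Proof.
elim: P q => [|[c e] P IH] q /=.
  by move=> -> _; rewrite meval0 add0r big1 // => j _; rewrite meval0 mulr0.
move=> [z [q' [sz _ Pq' ->]]] /andP[/eqP lin0 /(IH _ Pq') IHq].
rewrite mevalD mevalZ meval_monom //.
under eq_bigr => j _ do rewrite mevalD mevalZ meval_monom // mulrDr mulrCA.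
rewrite big_split /= addrACA IHq addr0 -big_distrr -mulrDr /=.
have := congr1 (@ratr algC) lin0; rewrite lincombE rmorphD rmorph_sum rmorph0 /= => E.
apply/eqP; rewrite mulf_eq0; apply/orP; right; apply/eqP; rewrite -[RHS]E.
by congr (_ + _); apply: eq_bigr => j _; rewrite -iter_watch -rmorphM.
Qed.

(** Generators of the tail ideal vanish at all later states, so the relation reduces to their value
    at the certified time, which is therefore zero; members of the ideal follow. *)
Lemma cert_closure n (A : seq apoly) (B : seq {mpoly algC[k.+1]}) :
  basis_den A B -> (forall p, in_ideal_gen B p <-> @inv_ideal (query_loop J (cert_time n)) p) ->
  cert_valid J n A -> ~~ cert_reached J n ->
  forall p, @inv_ideal (query_loop J (cert_time n)) p ->
    meval (@point algC k.+1 (s (cert_time n))) p = 0.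
Proof.
move=> [szAB denB] idB; rewrite /cert_valid => valid /negbTE nr; move: valid; rewrite nr.
move=> /allP valid p /idB[qs [_ ->]]; rewrite raddf_sum /=; apply: big1 => j _.
have lt_j : (j < size A)%N by rewrite szAB.
rewrite mevalM; apply/eqP; rewrite mulf_eq0; apply/orP; right; apply/eqP.
have := apoly_den_lincomb (denB j lt_j) (valid _ (mem_nth [::] lt_j)).
rewrite big1 ?addr0 // => l _.
have /idB/(_ l) := mem_ideal_gen (ltn_ord j); rewrite query_loop_state addnS -addSn => ->.
by rewrite mulr0.
Qed.

(* Once the target has been hit at time N, the tail after t lies in the union of y = 0
   and finitely many points, so a state in its closure with y <> 0 would recur. *)
Lemma cert_sound n (A : seq apoly) (B : seq {mpoly algC[k.+1]}) :
  basis_den A B -> (forall p, in_ideal_gen B p <-> @inv_ideal (query_loop J (cert_time n)) p) ->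
  cert_valid J n A -> ~~ cert_reached J n -> ~ p2p_reach I.
Proof.
move=> denB idB valid nr [m0 reach_m0].
have Hcl := cert_closure denB idB valid nr; move: Hcl nr.
rewrite /cert_reached; set t := cert_time n => Hcl /eqP yt1.
have exN : exists m, x m == p2p_target I by exists m0; apply/eqP.
have [N /eqP xN minN] := ex_minnP exN.
have y_after l : (N < l)%N -> head 0 (s l) = 0 by move=> lt_l; apply/head_watch_eq0; exists N.
have y_before l : (l <= N)%N -> head 0 (s l) <> 0.
  by move=> le_l /head_watch_eq0[m lt_m /eqP/minN]; rewrite leqNgt (leq_trans lt_m).
(* [y] is nonzero at [t.+1], so no hit occurs up to time [t]. *)
have lt_tN : (t < N)%N by rewrite ltnNge; apply/negP => le_Nt; apply: yt1; apply: y_after; rewrite ltnS.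
(* The product covers the times [t.+1] to [N], and from [N.+1] on the factor [y] vanishes; hence [p]
   is zero on the whole tail. *)
pose p : {mpoly algC[k.+1]} := 'X_ord0 * \prod_(j <- iota t.+1 (N - t)) sqdist_mpoly k.+1 (s j).
have evalp l : (meval (@point algC k.+1 (s l)) p == 0) =
    (head 0 (s l) == 0) || has (fun j => s l == s j) (iota t.+1 (N - t)).
  rewrite mevalM mevalXU rmorph_prod mulf_eq0 /point nth0 fmorph_eq0 prodf_seq_eq0.
  by congr (_ || _); apply: eq_has => j /=; rewrite meval_sqdist_mpoly ?size_watch.
have mem_j j : (j \in iota t.+1 (N - t)) = (t < j <= N)%N.
  by rewrite mem_iota addSn subnKC // ltnW.
have /Hcl/eqP : @inv_ideal (query_loop J t) p.
  move=> l; rewrite query_loop_state; apply/eqP; rewrite evalp; apply/orP.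
  have [le_N|/y_after->] := leqP (l + t.+1) N; last by left.
  by right; apply/hasP; exists (l + t.+1)%N; rewrite ?mem_j // le_N addnS ltnS leq_addl.
rewrite evalp => /orP[/eqP yt|/hasP[j]].
  by apply: yt1; rewrite head_watchS yt mul0r.
rewrite mem_j => /andP[lt_tj le_jN] /eqP st.
(* From the equal states at [t] and [j], run [N.+1 - j] steps: the second arrives at [N.+1], where
   [y] is zero, the first at a time at most [N] because [t < j], where [y] is not. *)
have := congr1 (iter (N.+1 - j) (step (watch_upd J))) st; rewrite !iter_watch subnK ?(leqW le_jN) // => sN.
apply: (y_before (N.+1 - j + t)%N); last by rewrite sN y_after.
by rewrite -ltnS -[X in (_ < X)%N](subnK (leqW le_jN)) ltn_add2l.
Qed.

End Watch.

Local Close Scope ring_scope.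

(* P2P is Turing-reducible to SPInv: a single oracle program decides every    *)
(* (well-formed) P2P instance, for every correct SPInv oracle.               *)
Theorem theorem4p2 :
  exists e : prog, forall O : nat -> nat, SPInv_oracle O ->
    forall I : p2p_inst, p2p_wf I ->
      (p2p_reach I -> eval O e [:: enc_p2p I] 1) /\
      (~ p2p_reach I -> eval O e [:: enc_p2p I] 0).
Proof.
have [e He] := @oracle_search algcode code_algcode.
exists e => O orcO I wfI.
pose oracle_answer t (A : seq apoly) := exists B : seq {mpoly algC[(p2p_k I).+1]},
  [/\ O (enc_loop (query_loop (inst_of I) t)) = enc_basis A, basis_den A B &
      forall p, in_ideal_gen B p <-> @inv_ideal (query_loop (inst_of I) t) p].
have ex_answer t : exists A, oracle_answer t A := orcO _ (query_loop_wf wfI t).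
(* Choice serves the analysis only; the program obtains the codes of these answers from [O]. *)
pose A t := proj1_sig (constructive_indefinite_description _ (ex_answer t)).
have AP t : oracle_answer t (A t).
  exact: proj2_sig (constructive_indefinite_description _ (ex_answer t)).
have sizeA t P m : P \in A t -> m \in P -> size m.2 = (p2p_k I).+1.
  have [B [_ [szAB denB] _]] := AP t => /(nthP [::])[j lt_j <-].
  exact: apoly_den_size (denB j lt_j).
have [N valN minN] := ex_minnP (cert_exists sizeA).
have ev : eval O e [:: enc_p2p I] (cert_reached (inst_of I) N).
  rewrite -encode_inst; apply: (He O _ (fun n => A (cert_time n))) => // n.
    by rewrite encode_basis encode_query; have [B []] := AP (cert_time n).
  by move=> lt_nN; apply: contraL lt_nN => /minN; rewrite -leqNgt.
have [B [_ denB idB]] := AP (cert_time N).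
have sound := cert_sound wfI denB idB valN.
(* The certificate found either witnesses a hit, with output 1, or excludes one by soundness, with
   output 0; in each case the other implication is vacuous. *)
case: (boolP (cert_reached (inst_of I) N)) sound ev => [/eqP r|nr] sound ev; split=> //.
- by move/(head_watch_eq0 wfI): r => [m _ xm] []; exists m.
- by move=> r; case: (sound isT).
Qed.
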